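(* Let $F\in\mathbb{R}^{3\times 3}$ with $\det[F]>0$, with singular value decomposition $F=USV^T$, $U,V\in\mathsf{SO(3)}$, $S=\mathrm{diag}[s_1,s_2,s_3]$, $s_1,s_2,s_3>0$, and let $M=UV^T$. Suppose the parameter $\sigma<1$ and the seven sigma points \[ \{M\}\cup\{R_i(\theta_i),R_i(-\theta_i)\mid i\in\{1,2,3\}\} \] of the matrix Fisher distribution $\mathcal{M}(F)$ are given (as defined in the context). Let $\bar R\in\mathbb{R}^{3\times 3}$ be the arithmetic mean of the sigma points, \[ \bar R=\frac17\left[M+\sum_{i=1}^3\{R_i(\theta_i)+R_i(-\theta_i)\}\right]. \] Then the singular value decomposition of $\bar R$ is given by \[ \bar R=UDV^T, \] with the same $U,V\in\mathsf{SO(3)}$ as in $F=USV^T$, and $D=\mathrm{diag}[d_1,d_2,d_3]\in\mathbb{R}^{3\times 3}$, where for each $(i,j,k)\in\{(1,2,3),(2,3,1),(3,1,2)\}$, \[ d_i=\frac17\bigl(3+2(\cos\theta_j+\cos\theta_k)\bigr). \]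
   Context: $\mathsf{SO(3)}=\{R\in\mathbb{R}^{3\times 3}\mid R^TR=I_{3\times 3},\ \det[R]=1\}$, with Haar measure $dR$ normalized so that $\int_{\mathsf{SO(3)}}dR=1$. The matrix Fisher distribution $\mathcal{M}(F)$ with matrix parameter $F\in\mathbb{R}^{3\times3}$ has density $p(R)=\frac{1}{c(F)}\exp(\mathrm{tr}[F^TR])$ with respect to $dR$, where $c(A)=\int_{\mathsf{SO(3)}}\exp(\mathrm{tr}[A^TR])\,dR$ for any $A\in\mathbb{R}^{3\times 3}$. For $x\in\mathbb{R}^3$, $\hat x\in\mathbb{R}^{3\times 3}$ is the skew-symmetric matrix with $\hat x y=x\times y$ for all $y\in\mathbb{R}^3$; $e_i$ is the $i$-th column of $I_{3\times 3}$; and $\exp$ of a matrix is the matrix exponential. Sigma points: given $F=USV^T$ as in the claim, for an angle $\theta_i$ let \[ R_i(\theta_i)=\exp(\theta_i\widehat{Ue_i})\,UV^T=U\exp(\theta_i\hat e_i)V^T,\qquad i\in\{1,2,3\}. \] For a parameter $\sigma<1$, the seven sigma points are $M=UV^T$ together with $R_i(\theta_i)$ and $R_i(-\theta_i)$ for $i\in\{1,2,3\}$, where the angle $\theta_i$ is chosen so that \[ \cos\theta_i=\frac{(1-\sigma)\log c(S)+\sigma s_T-s_i}{s_j+s_k},\qquad s_T=s_1+s_2+s_3, \] for $(i,j,k)\in\{(1,2,3),(2,3,1),(3,1,2)\}$. That the sigma points are given means that such real angles $\theta_1,\theta_2,\theta_3$ exist and have been chosen. *)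

(* Defs.v *)
(* MathComp-Analysis, over an arbitrary [R : realType]. *)
From HB Require Import structures.
From mathcomp Require Import all_boot all_order all_algebra.
From mathcomp Require Import all_classical all_reals all_analysis.
Set Implicit Arguments.
Unset Strict Implicit.
Unset Printing Implicit Defensive.
Import Order.TTheory GRing.Theory Num.Theory.
Import numFieldNormedType.Exports.
Local Open Scope classical_set_scope.
Local Open Scope ring_scope.

(* Throughout, coordinates are indexed by 'I_3 = {0, 1, 2} with its arithmetic
   modulo 3: for [i : 'I_3], the triple (i, i + 1, i + 2) is a cyclic
   permutation of (0, 1, 2). *)

Definition SO3 (R : realType) : set 'M[R]_3 :=
  [set Q | Q^T *m Q = 1%:M /\ \det Q = 1].

Definition borelM3 (R : realType) :=
  g_sigma_algebraType (@open 'M[R]_3).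

(* The normalized Haar measure of SO(3), viewed as a Borel probability measure
   on the ambient matrix space carried by SO(3) and invariant under left
   translations by SO(3).  These properties determine it uniquely. *)
Definition is_haar_SO3 (R : realType) (mu : probability (borelM3 R) R) : Prop :=
  mu (@SO3 R) = 1%E /\
  forall Q : 'M[R]_3, SO3 Q -> forall A : set (borelM3 R), measurable A ->
    mu [set X : borelM3 R | A (Q *m (X : 'M[R]_3))] = mu A.

(* Normalizing constant of the matrix Fisher distribution, whose density with
   respect to [mu] is exp(tr(F^T X)) / c(F). *)
Definition fisher_c (R : realType) (mu : probability (borelM3 R) R)
    (A : 'M[R]_3) : R :=
  \int[mu]_(X in @SO3 R) expR (\tr (A^T *m (X : 'M[R]_3))).

Definition cross (R : realType) (x y : 'cV[R]_3) : 'cV[R]_3 :=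
  \col_i (x (i + 1) 0 * y (i + 2) 0 - x (i + 2) 0 * y (i + 1) 0).

(* The j-th column of [hat x] is [cross x e_j]. *)
Definition hat (R : realType) (x : 'cV[R]_3) : 'M[R]_3 :=
  \matrix_(i, j) cross x (delta_mx j 0) i 0.

Lemma hatE (R : realType) (x y : 'cV[R]_3) : hat x *m y = cross x y.
Proof.
apply/colP => i; rewrite [LHS]mxE [RHS]mxE.
have hatij j : hat x i j = x (i + 1) 0 * (i + 2 == j)%:R
    - x (i + 2) 0 * (i + 1 == j)%:R.
  by rewrite !mxE !eqxx !andbT.
rewrite (eq_bigr (fun j => x (i + 1) 0 * ((i + 2 == j)%:R * y j 0)
    - x (i + 2) 0 * ((i + 1 == j)%:R * y j 0))); last first.
  by move=> j _; rewrite hatij mulrBl -!mulrA.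
have pick (k : 'I_3) : \sum_(j < 3) (k == j)%:R * y j 0 = y k 0.
  rewrite (bigD1 k) //= eqxx mul1r big1 ?addr0 // => j /negPf jk.
  by rewrite eq_sym jk mul0r.
by rewrite big_split /= sumrN -!mulr_sumr !pick.
Qed.

Lemma hat_skew (R : realType) (x : 'cV[R]_3) : (hat x)^T = - hat x.
Proof.
apply/matrixP => i j; rewrite !mxE !eqxx !andbT opprB.
by case: i => -[|[|[|//]]] ?; case: j => -[|[|[|//]]] ?;
  rewrite /= ?(mulr0, mulr1, subr0, sub0r); do ?[congr (- _)];
  do ?[congr (x _ _)]; apply/val_inj.
Qed.

(* Matrix exponential: sum of the series, for the norm topology of 'M[R]_3. *)
Definition expmx3 (R : realType) (A : 'M[R]_3) : 'M[R]_3 :=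
  limn (series (fun n : nat => n`!%:R^-1 *: A ^+ n)).

Definition sigma_point (R : realType) (U V : 'M[R]_3) (i : 'I_3) (t : R) :
    'M[R]_3 :=
  expmx3 (t *: hat (U *m delta_mx i 0)) *m U *m V^T.

(* The (real) angles [theta] realize the sigma points with parameter [sigma]
   for the matrix Fisher distribution with singular values [s]. *)
Definition sigma_angles (R : realType) (mu : probability (borelM3 R) R)
    (s : 'rV[R]_3) (sigma : R) (theta : 'I_3 -> R) : Prop :=
  forall i : 'I_3,
    cos (theta i) =
      ((1 - sigma) * ln (fisher_c mu (diag_mx s))
         + sigma * (\sum_j s 0 j) - s 0 i)
      / (s 0 (i + 1) + s 0 (i + 2)).

Definition sigma_mean (R : realType) (U V : 'M[R]_3) (theta : 'I_3 -> R) :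
    'M[R]_3 :=
  7^-1 *: (U *m V^T
    + \sum_i (sigma_point U V i (theta i) + sigma_point U V i (- theta i))).

(* A = U diag(d) V^T with both orthogonal factors in SO(3).  No ordering and no
   sign is prescribed for the entries of [d]. *)
Definition rot_svd (R : realType) (A U : 'M[R]_3) (d : 'rV[R]_3)
    (V : 'M[R]_3) : Prop :=
  [/\ SO3 U, SO3 V & A = U *m diag_mx d *m V^T].

(* Main.v *)
(** Write u for a column of U and K = hat u.  Since u is a unit vector,
    K^2 = u u^T - 1 and K^3 = - K, so the exponential series splits into the
    sine and cosine series (Rodrigues' formula):
    exp(tK) = 1 + sin t K + (1 - cos t) K^2.  In exp(tK) + exp(-tK) the sine
    terms cancel, and as K^2 U = U (E_ii - 1) what remains is diagonal once
    conjugated by U. *)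
Require Import Defs.
From HB Require Import structures.
From mathcomp Require Import all_boot all_order all_algebra.
From mathcomp Require Import all_classical all_reals all_analysis.
From mathcomp Require Import ring.
Import Order.TTheory GRing.Theory Num.Theory.
Import numFieldNormedType.Exports.
Local Open Scope classical_set_scope.
Local Open Scope ring_scope.

Lemma ord3P (k : 'I_3) : [\/ k = 0, k = 1 | k = 2].
Proof.
by case: k => -[|[|[|//]]] p; [constructor 1|constructor 2|constructor 3];
  exact: val_inj.
Qed.

(** Brings the indices left by [big_ord_recl] and by addition modulo 3 to the literals 0, 1, 2, so
    that [ring] sees equal entries as equal atoms. *)
Lemma ord3E :
  ((ord0 = 0 :> 'I_3)%R * (lift ord0 ord0 = 1 :> 'I_3)%R
    * (lift ord0 (lift ord0 ord0) = 2 :> 'I_3)%R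
    * (0 + 1 = 1 :> 'I_3)%R * (0 + 2 = 2 :> 'I_3)%R
    * (1 + 1 = 2 :> 'I_3)%R * (1 + 2 = 0 :> 'I_3)%R
    * (2 + 1 = 0 :> 'I_3)%R * (2 + 2 = 1 :> 'I_3)%R)%type.
Proof. by do !split; exact: val_inj. Qed.

Lemma cross_self (R : realType) (x : 'cV[R]_3) : cross x x = 0.
Proof. by apply/colP => i; rewrite !mxE mulrC subrr. Qed.

(** Matrix form of the triple product expansion x × (x × y) = (x · y) x - (x · x) y. *)
Lemma hat_sqr (R : realType) (x : 'cV[R]_3) :
  hat x *m hat x = x *m x^T - ((x^T *m x) 0 0)%:M.
Proof.
apply/matrixP => i j; rewrite !mxE !big_ord_recl !big_ord0 !mxE !eqxx !andbT.
rewrite !ord1 !ord3E.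
by case: (ord3P i) => ->; case: (ord3P j) => ->; rewrite ?ord3E /=; ring.
Qed.

Lemma hat_cube (R : realType) (x : 'cV[R]_3) :
  x^T *m x = 1%:M -> hat x ^+ 3 = - hat x.
Proof.
move=> x1; rewrite !exprS expr0 mulr1 -!mulmxE hat_sqr x1 mxE eqxx.
by rewrite mulmxBr mulmxA hatE cross_self mul0mx sub0r mulmx1.
Qed.

(** The relation on K makes its odd powers ±K and its positive even powers ±K^2. The power K^0 = 1
    escapes this pattern: at n = 0 the cosine term gives -K^2, which the correction 1 + K^2 turns
    into 1. *)
Lemma expX_sin_cos_coeff (R : realType) (A : algType R) (K : A) (t : R)
    (n : nat) :
  K ^+ 3 = - K ->
  n`!%:R^-1 *: (t *: K) ^+ n = (n == 0%N)%:R *: (1 + K ^+ 2)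
    + sin_coeff t n *: K - cos_coeff t n *: K ^+ 2.
Proof.
move=> K3; rewrite /sin_coeff /cos_coeff /=.
have Kodd m : K ^+ m.*2.+1 = (-1) ^+ m *: K.
  elim: m => [|m IH]; first by rewrite expr0 expr1 scale1r.
  rewrite doubleS -(addn2 m.*2.+1) exprD IH -scalerAl -exprS K3 scalerN -scaleNr.
  by rewrite exprS mulN1r.
have Keven m : K ^+ m.+1.*2 = (-1) ^+ m *: K ^+ 2.
  by rewrite doubleS exprS Kodd -scalerAr.
rewrite exprZn scalerA.
have [m [->|->]] : exists m, n = m.*2.+1 \/ n = m.*2.
  by exists n./2; rewrite -{1 3}(odd_double_half n); case: (odd n); [left|right].
  rewrite Kodd scalerA /= !odd_double doubleK /=.
  by rewrite !(scale0r, mul0r, subr0, add0r, mul1r); congr (_ *: _); ring.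
case: m => [|m].
  by rewrite !(expr0, fact0, invr1, mul0r, scale0r, addr0, mul1r, scale1r,
    expr0z, addrK) /=.
rewrite Keven scalerA /=.
rewrite !odd_double doubleK !(scale0r, mul0r, add0r, mul1r) -scaleNr.
by congr (_ *: _); rewrite -exprnP exprS; ring.
Qed.

(* Rodrigues' rotation formula. *)
Lemma expmx3_scale (R : realType) (K : 'M[R]_3) (t : R) :
  K ^+ 3 = - K -> expmx3 (t *: K) = 1 + sin t *: K + (1 - cos t) *: K ^+ 2.
Proof.
move=> K3; rewrite /expmx3.
under eq_fun do rewrite (expX_sin_cos_coeff _ _ _ t _ K3).
(* The partial sum of index 0 is empty; from index 1 on they all equal 1. *)
have sum0 : series (fun n : nat => (n == 0%N)%:R : R) @ \oo --> (1 : R).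
  apply: cvg_near_cst; exists 1%N => // n /= n0.
  by rewrite /series /= big_ltn // big_nat big1 ?addr0 // => -[].
have -> : series (fun n => (n == 0%N)%:R *: (1 + K ^+ 2)
    + sin_coeff t n *: K - cos_coeff t n *: K ^+ 2) =
  (fun n => series (fun n : nat => (n == 0%N)%:R : R) n *: (1 + K ^+ 2)
    + series (sin_coeff t) n *: K - series (cos_coeff t) n *: K ^+ 2).
  apply/funext => n; rewrite /series /= !scaler_suml.
  by rewrite -big_split -sumrB.
(* Regroups the limit in the shape of the three scalar series above. *)
have -> : 1 + sin t *: K + (1 - cos t) *: K ^+ 2
    = (1 : R) *: (1 + K ^+ 2) + sin t *: K - cos t *: K ^+ 2.
  by rewrite scale1r scalerBl scale1r addrA -(addrA 1) (addrC (_ *: K)) addrA.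
apply: cvg_lim; first exact: norm_hausdorff.
have ssin : series (sin_coeff t) @ \oo --> sin t.
  by rewrite sin.unlock; exact: is_cvg_series_sin_coeff.
have scos : series (cos_coeff t) @ \oo --> cos t.
  by rewrite cos.unlock; exact: is_cvg_series_cos_coeff.
by apply: cvgB; [apply: cvgD|]; exact: cvgZr_tmp.
Qed.

Lemma sigma_pointD (R : realType) (U V : 'M[R]_3) (i : 'I_3) (t : R) :
  SO3 U -> sigma_point U V i t + sigma_point U V i (- t)
    = U *m (2%:M + (2 * (1 - cos t)) *: (delta_mx i i - 1%:M)) *m V^T.
Proof.
move=> [UU _]; rewrite /sigma_point.
set x := U *m delta_mx i 0.
have x1 : x^T *m x = 1%:M.
  rewrite /x trmx_mul trmx_delta mulmxA -(mulmxA _ U^T) UU mulmx1 mul_delta_mx.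
  by apply/matrixP => k l; rewrite !ord1 !mxE !eqxx.
(* Since U^T U = 1, x^T U is the i-th unit row, so x x^T U = U E_ii. *)
have KU : hat x ^+ 2 *m U = U *m (delta_mx i i - 1%:M).
  rewrite expr2 -mulmxE hat_sqr x1 mxE eqxx mulmxBl mul1mx mulmxBr mulmx1.
  rewrite /x trmx_mul trmx_delta -!mulmxA UU mulmx1.
  by rewrite mul_delta_mx.
rewrite !expmx3_scale ?hat_cube// sinN cosN -!mulmxDl; congr (_ *m _).
rewrite addrACA scaleNr [X in X + _]addrACA subrr addr0 -scalerDl -!mulr2n.
rewrite mulmxDl -scalemxAl KU mulr_natl [RHS]mulmxDr -scalemxAr; congr (_ + _).
by rewrite -[2 : 'M[R]_3]scaler_nat mul_mx_scalar -scalemxAl mul1mx.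
Qed.

Theorem proposition3 (R : realType)
    (mu : probability (borelM3 R) R) (Hmu : is_haar_SO3 mu)
    (F U V : 'M[R]_3) (s : 'rV[R]_3)
    (HdetF : 0 < \det F)
    (HF : rot_svd F U s V) (Hs : forall i : 'I_3, 0 < s 0 i)
    (sigma : R) (Hsigma : sigma < 1)
    (theta : 'I_3 -> R) (Htheta : sigma_angles mu s sigma theta) :
  rot_svd (sigma_mean U V theta) U
    (\row_i (7^-1 * (3 + 2 * (cos (theta (i + 1)) + cos (theta (i + 2))))))
    V.
Proof.
case: HF => HU HV _; split=> //; rewrite /sigma_mean.
under eq_bigr do rewrite sigma_pointD//.
(* With M read as U 1 V^T, all terms share the outer factors U and V^T; only the middle factors
   remain to be compared. *)
rewrite -{1}(mulmx1 U) -mulmx_suml -mulmx_sumr -mulmxDl -mulmxDr.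
rewrite scalemxAl scalemxAr; congr (_ *m _ *m _).
apply/matrixP => k l.
(* In diagonal entry k, M contributes 1, the pair of axis k contributes 2, and each other pair i
   contributes 2 - 2 (1 - cos theta_i) = 2 cos theta_i. *)
rewrite !big_ord_recl big_ord0 !mxE !ord3E.
by case: (ord3P k) => ->; case: (ord3P l) => ->; rewrite ?ord3E /=;
  ring.
Qed.
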